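(* INF proves that the Church counting axiom, $\forall j\in\mathbb{N}\,(j\,\mathsf{S}\,\mathbf{0}=j)$, implies that the set $\mathbb{N}$ of Church numbers is infinite and that Church successor is one-to-one on $\mathbb{N}$ (for all $x,y\in\mathbb{N}$, $\mathsf{S}x=\mathsf{S}y\to x=y$).
   Context: INF (intuitionistic New Foundations) is the first-order theory with equality over intuitionistic logic, with one binary predicate $\in$, whose axioms are extensionality ($\forall z(z\in x\leftrightarrow z\in y)\to x=y$) and stratified comprehension (the set $\{x:\varphi\}$ exists for every stratified $\varphi$, parameters allowed; $\varphi$ is stratified if its variables can be assigned natural-number indices so that in each subformula $x\in y$ the index of $y$ is one more than that of $x$, and in each $x=y$ the indices agree). Ordered pairs are $\langle x,y\rangle=\{\{x\},\{x,y\}\}$. $\mathrm{FUNC}=\{f:\forall x,y,z(\langle x,y\rangle\in f\to\langle x,z\rangle\in f\to y=z)\}$. Application: $Ap(f,x)=\{t:\exists y(\langle x,y\rangle\in f\land t\in y)\}$, so $Ap(f,x)=y$ if $f\in\mathrm{FUNC}$ and $\langle x,y\rangle\in f$. Write $fx$ for $Ap(f,x)$, associating to the left; so $j\,\mathsf{S}\,\mathbf{0}$ means $Ap(Ap(j,\mathsf{S}),\mathbf{0})$. Church numbers: $\mathbf{0}=\{\langle f,\mathrm{id}\rangle: f=f\}$ with $\mathrm{id}=\{\langle x,x\rangle:x=x\}$. Church successor is the set of all pairs $\langle z,s_z\rangle$ with $z\in\mathrm{FUNC}$, where $s_z$ is the set of all $\langle f,p\rangle$ with $f\in\mathrm{FUNC}$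 and $\forall u\,(u\in p\leftrightarrow\exists x,w,t,q\,(u=\langle x,w\rangle\land t\in\mathrm{FUNC}\land\langle f,t\rangle\in z\land\langle x,q\rangle\in t\land\langle q,w\rangle\in f))$; it is denoted $\mathsf{S}$. $\mathbb{N}$ is the intersection of all sets containing $\mathbf{0}$ and closed under $\mathsf{S}$. A set $X$ is infinite (Dedekind) if there is $Y\subseteq X$ with $Y\neq X$ and $X\sim Y$, where $X\sim Y$ means that some relation is a one-to-one function from $X$ onto $Y$. *)

(* Defs.v *)
From Stdlib Require Import List.

Set Implicit Arguments.

(** * First-order formulas over the signature of set theory

    Variables are de Bruijn indices and are the only terms: [0] is the variable
    bound by the innermost quantifier, and indices that point outside all
    quantifiers are free variables (parameters).  Negation is [A ⇒ ⊥]. *)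

Inductive form : Type :=
| Mem (x y : nat)
| Eq (x y : nat)
| Bot
| And (A B : form)
| Or (A B : form)
| Imp (A B : form)
| All (A : form)
| Ex (A : form).

Declare Scope form_scope.
Delimit Scope form_scope with form.
Bind Scope form_scope with form.
Open Scope form_scope.

Notation "x ∈ y" := (Mem x y) (at level 70, no associativity) : form_scope.
Notation "x ≐ y" := (Eq x y) (at level 70, no associativity) : form_scope.
Notation "⊥" := Bot : form_scope.
Notation "A ∧ B" := (And A B) (at level 80, right associativity) : form_scope.
Notation "A ∨ B" := (Or A B) (at level 85, right associativity) : form_scope.
Notation "A ⇒ B" := (Imp A B) (at level 99, right associativity) : form_scope.

Definition Iff (A B : form) : form := (A ⇒ B) ∧ (B ⇒ A).
Notation "A ⇔ B" := (Iff A B) (at level 95, no associativity) : form_scope.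

Definition scons {X : Type} (t : X) (s : nat -> X) (n : nat) : X :=
  match n with 0 => t | S m => s m end.

Definition up (r : nat -> nat) : nat -> nat := scons 0 (fun n => S (r n)).

(** Since variables are the only terms, renaming covers all substitutions. *)
Fixpoint ren (r : nat -> nat) (A : form) : form :=
  match A with
  | x ∈ y => r x ∈ r y
  | x ≐ y => r x ≐ r y
  | ⊥ => ⊥
  | B ∧ C => ren r B ∧ ren r C
  | B ∨ C => ren r B ∨ ren r C
  | B ⇒ C => ren r B ⇒ ren r C
  | All B => All (ren (up r) B)
  | Ex B => Ex (ren (up r) B)
  end.

Definition shift : form -> form := ren S.
Definition inst (t : nat) : form -> form := ren (scons t (fun n => n)).

(** * Intuitionistic natural deduction with equality

    Free variables of an axiom in [T] are implicitly universally quantified: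
    the rules for [All] and [Ex] constrain only the hypotheses in [G]. *)

Inductive prv (T : form -> Prop) : list form -> form -> Prop :=
| prv_axiom G A : T A -> prv T G A
| prv_hyp G A : In A G -> prv T G A
| prv_botE G A : prv T G ⊥ -> prv T G A
| prv_andI G A B : prv T G A -> prv T G B -> prv T G (A ∧ B)
| prv_andE1 G A B : prv T G (A ∧ B) -> prv T G A
| prv_andE2 G A B : prv T G (A ∧ B) -> prv T G B
| prv_orI1 G A B : prv T G A -> prv T G (A ∨ B)
| prv_orI2 G A B : prv T G B -> prv T G (A ∨ B)
| prv_orE G A B C :
    prv T G (A ∨ B) -> prv T (A :: G) C -> prv T (B :: G) C -> prv T G C
| prv_impI G A B : prv T (A :: G) B -> prv T G (A ⇒ B)
| prv_impE G A B : prv T G (A ⇒ B) -> prv T G A -> prv T G B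
| prv_allI G A : prv T (map shift G) A -> prv T G (All A)
| prv_allE G A t : prv T G (All A) -> prv T G (inst t A)
| prv_exI G A t : prv T G (inst t A) -> prv T G (Ex A)
| prv_exE G A B :
    prv T G (Ex A) -> prv T (A :: map shift G) (shift B) -> prv T G B
| prv_eqI G x : prv T G (x ≐ x)
| prv_eqE G A x y : prv T G (x ≐ y) -> prv T G (inst x A) -> prv T G (inst y A).

(** * The theory INF *)

(** [strat s A]: [A] is stratified by an assignment of indices to its variables
    that gives the free variable [n] the index [s n]. *)
Fixpoint strat (s : nat -> nat) (A : form) : Prop :=
  match A with
  | x ∈ y => s y = S (s x)
  | x ≐ y => s x = s y
  | ⊥ => True
  | B ∧ C => strat s B /\ strat s C
  | B ∨ C => strat s B /\ strat s C
  | B ⇒ C => strat s B /\ strat s C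
  | All B => exists i, strat (scons i s) B
  | Ex B => exists i, strat (scons i s) B
  end.

Definition stratified (A : form) : Prop := exists s, strat s A.

(** [isset a A] expresses a = {z : A}, where [z] is the variable [0] of [A] and
    the variable [n] outside is the variable [S n] in [A]. *)
Definition isset (a : nat) (A : form) : form := All (0 ∈ S a ⇔ A).

Definition extensionality : form :=
  All (All (All (0 ∈ 2 ⇔ 0 ∈ 1) ⇒ 1 ≐ 0)).

(** The renaming [up S] keeps the set variable [0] distinct from the variables
    of [A]: the new set must not occur in its own defining formula. *)
Definition comprehension (A : form) : form := Ex (isset 0 (ren (up S) A)).

Inductive INF : form -> Prop :=
| INF_ext : INF extensionality
| INF_comp A : stratified A -> INF (comprehension A).

(** * Sets, pairs and functions

    The arguments of these macros are variables.  A set-builder term is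
    eliminated in favour of the formula saying that a variable equals it, so that
    a statement about such a term becomes "some set equal to it satisfies ...". *)

Definition is_singleton (a x : nat) : form := isset a (0 ≐ S x).

Definition is_upair (a x y : nat) : form := isset a (0 ≐ S x ∨ 0 ≐ S y).

(** u = ⟨x,y⟩ *)
Definition is_opair (u x y : nat) : form :=
  Ex (Ex (is_singleton 1 (2 + x) ∧ is_upair 0 (2 + x) (2 + y)
          ∧ is_upair (2 + u) 1 0)).

(** ⟨x,y⟩ ∈ f *)
Definition opair_in (x y f : nat) : form :=
  Ex (is_opair 0 (S x) (S y) ∧ 0 ∈ S f).

(** f ∈ FUNC *)
Definition in_FUNC (f : nat) : form :=
  All (All (All (opair_in 2 1 (3 + f) ⇒ opair_in 2 0 (3 + f) ⇒ 1 ≐ 0))).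

(** r = Ap(f,x) *)
Definition is_Ap (r f x : nat) : form :=
  isset r (Ex (opair_in (2 + x) 0 (2 + f) ∧ 1 ∈ 0)).

(** * Church numbers *)

Definition is_id (i : nat) : form := isset i (Ex (0 ≐ 0 ∧ is_opair 1 0 0)).

Definition is_zero (o : nat) : form :=
  isset o (Ex (0 ≐ 0 ∧ Ex (is_id 0 ∧ is_opair 2 1 0))).

(** p = {⟨x,w⟩ : ∃ t q, t ∈ FUNC, ⟨f,t⟩ ∈ z, ⟨x,q⟩ ∈ t, ⟨q,w⟩ ∈ f};
    inside, [4] is the element and [3], [2], [1], [0] are x, w, t, q. *)
Definition is_succ_map (p f z : nat) : form :=
  isset p (Ex (Ex (Ex (Ex (
    is_opair 4 3 2 ∧ in_FUNC 1 ∧ opair_in (5 + f) 1 (5 + z)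
    ∧ opair_in 3 0 1 ∧ opair_in 0 2 (5 + f)))))).

(** a = s_z *)
Definition is_succ_of (a z : nat) : form :=
  isset a (Ex (Ex (is_opair 2 1 0 ∧ in_FUNC 1 ∧ is_succ_map 0 1 (3 + z)))).

(** s = the graph {⟨z,s_z⟩ : z ∈ FUNC} of Church successor *)
Definition is_succ (s : nat) : form :=
  isset s (Ex (Ex (is_opair 2 1 0 ∧ in_FUNC 1 ∧ is_succ_of 0 1))).

(** n = ℕ, given o = 0 and the successor graph s *)
Definition is_N (n o s : nat) : form :=
  isset n (All (
    2 + o ∈ 0 ∧ All (0 ∈ 1 ⇒ Ex (is_Ap 0 (4 + s) 1 ∧ 0 ∈ 2)) ⇒ 1 ∈ 0)).

(** * Similarity and infinity *)

Definition is_relation (r : nat) : form :=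
  All (0 ∈ S r ⇒ Ex (Ex (is_opair 2 1 0))).

Definition one_to_one (r : nat) : form :=
  All (All (All (opair_in 2 0 (3 + r) ⇒ opair_in 1 0 (3 + r) ⇒ 2 ≐ 1))).

Definition is_domain (a r : nat) : form := isset a (Ex (opair_in 1 0 (2 + r))).

Definition is_range (a r : nat) : form := isset a (Ex (opair_in 0 1 (2 + r))).

Definition similar (a b : nat) : form :=
  Ex (is_relation 0 ∧ in_FUNC 0 ∧ one_to_one 0
      ∧ is_domain (S a) 0 ∧ is_range (S b) 0).

Definition subset (a b : nat) : form := All (0 ∈ S a ⇒ 0 ∈ S b).

Definition infinite (a : nat) : form :=
  Ex (subset 0 (S a) ∧ (0 ≐ S a ⇒ ⊥) ∧ similar (S a) 0).

(** * The counting axiom and injectivity of successor *)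

(** ∀ j ∈ n, Ap(Ap(j,s),o) = j *)
Definition church_counting (n s o : nat) : form :=
  All (0 ∈ S n ⇒
       Ex (Ex (is_Ap 1 2 (3 + s) ∧ is_Ap 0 1 (3 + o) ∧ 0 ≐ 2))).

(** ∀ x y ∈ n, Ap(s,x) = Ap(s,y) → x = y *)
Definition succ_injective (n s : nat) : form :=
  All (All (1 ∈ 2 + n ⇒ 0 ∈ 2 + n ⇒
    Ex (Ex (is_Ap 1 (4 + s) 3 ∧ is_Ap 0 (4 + s) 2 ∧ 1 ≐ 0)) ⇒ 1 ≐ 0)).

(* Main.v *)
(** Let [s] be the Church successor and let [f] extend [s] by the single pair
    ⟨V,0⟩, where V is the universe; [f] is a function because V is not in FUNC, the
    domain of [s].  Iterating [f] from V is iterating [s] from 0 with a delay of one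
    step, so induction on [j] gives (j+1) f V = j s 0, which is [j] by the counting
    axiom.  Hence j+1 determines [j].  Applied to the empty function, a successor
    yields the empty function while 0 yields the identity, so 0 is no successor and
    [s] maps ℕ one-to-one onto a proper subset. *)

Require Import Defs.
From Stdlib Require Import List Arith Lia.

Set Implicit Arguments.

Notation "G ⊢ A" := (prv INF G A%form) (at level 98, A at level 97).

(** * Renamings *)

Lemma ren_id A : forall r, (forall n, r n = n) -> ren r A = A.
Proof.
  induction A; cbn; intros r H; f_equal; auto;
    (apply IHA; intros [|n]; cbn; auto).
Qed.

Lemma ren_ren A : forall r r' r'', (forall n, r' (r n) = r'' n) ->
  ren r' (ren r A) = ren r'' A.
Proof.
  induction A; cbn; intros r r' r'' H; f_equal; auto;
    (apply IHA; intros [|n]; cbn; auto).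
Qed.

Lemma ren_inst r t A : ren r (inst t A) = inst (r t) (ren (up r) A).
Proof.
  unfold inst.
  rewrite (ren_ren A _ _ (scons (r t) r)) by (intros [|n]; reflexivity).
  symmetry; apply ren_ren; intros [|n]; reflexivity.
Qed.

Lemma ren_shift r A : ren (up r) (shift A) = shift (ren r A).
Proof.
  unfold shift.
  rewrite (ren_ren A _ _ (fun n => S (r n))) by reflexivity.
  symmetry; apply ren_ren; reflexivity.
Qed.

Lemma map_ren_shift r G :
  map (ren (up r)) (map shift G) = map shift (map (ren r) G).
Proof. rewrite !map_map; apply map_ext, ren_shift. Qed.

Lemma strat_ext A : forall s s', (forall n, s n = s' n) -> strat s A -> strat s' A.
Proof.
  induction A; cbn; intros s s' H; rewrite <- ?H; firstorder eauto;
    exists x; (eapply IHA; [|eassumption]); intros [|n]; cbn; auto.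
Qed.

(** A renaming that identifies variables can destroy stratification. The left inverse [k] excludes
    this and tells which index each renamed variable inherits. *)
Lemma strat_ren A : forall r k s, (forall n, k (r n) = n) ->
  strat s A -> strat (fun n => s (k n)) (ren r A).
Proof.
  induction A; cbn; intros r k s H; rewrite ?H; try tauto; try (now firstorder).
  all: intros [i Hi]; exists i.
  all: eapply strat_ext, (IHA (up r) (up k)), Hi; intros [|n]; cbn; auto.
Qed.

Lemma INF_ren r k A : (forall n, k (r n) = n) -> INF A -> INF (ren r A).
Proof.
  intros H [|B [s Hs]].
  - apply INF_ext.
  - replace (ren r (comprehension B)) with (comprehension (ren (up r) B)).
    + apply INF_comp. exists (fun n => s (up k n)). apply strat_ren; auto.
      intros [|n]; cbn; auto.
    + unfold comprehension, isset, Iff; cbn [ren].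
      rewrite !(ren_ren B _ _ (up (fun n => S (r n)))); auto;
        intros [|n]; reflexivity.
Qed.

(** This makes room for eigenvariables: no variable from [N] on occurs free in [A]. *)
Lemma fv_bound A :
  exists N, forall r r', (forall n, n < N -> r n = r' n) -> ren r A = ren r' A.
Proof.
  induction A.
  1, 2: exists (S (x + y)); intros r r' H; cbn; rewrite !H by lia; reflexivity.
  1: exists 0; reflexivity.
  1-3: destruct IHA1 as [N1 H1], IHA2 as [N2 H2]; exists (N1 + N2);
    intros r r' H; cbn; f_equal; [apply H1 | apply H2]; intros; apply H; lia.
  all: destruct IHA as [N HN]; exists N; intros r r' H; cbn; f_equal; apply HN;
    intros [|n] Hn; cbn; auto; f_equal; apply H; lia.
Qed.

Lemma fv_bound_list G :
  exists N, forall r r', (forall n, n < N -> r n = r' n) ->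
    map (ren r) G = map (ren r') G.
Proof.
  induction G as [|A G [N H]].
  - exists 0; reflexivity.
  - destruct (fv_bound A) as [M HM]; exists (M + N); intros r r' Hr; cbn; f_equal;
      [apply HM | apply H]; intros; apply Hr; lia.
Qed.

(** * Derivations *)

Lemma weak T G A : prv T G A -> forall G', incl G G' -> prv T G' A.
Proof.
  induction 1; intros G' I.
  - apply prv_axiom; auto.
  - apply prv_hyp; auto.
  - apply prv_botE; auto.
  - apply prv_andI; auto.
  - eapply prv_andE1; auto.
  - eapply prv_andE2; auto.
  - apply prv_orI1; auto.
  - apply prv_orI2; auto.
  - eapply prv_orE; [apply IHprv1 | apply IHprv2 | apply IHprv3];
      auto using incl_cons, incl_tl, in_eq with datatypes.
  - apply prv_impI, IHprv; auto using incl_cons, incl_tl, in_eq with datatypes.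
  - eapply prv_impE; auto.
  - apply prv_allI, IHprv, incl_map, I.
  - apply prv_allE; auto.
  - eapply prv_exI; auto.
  - eapply prv_exE; [apply IHprv1, I | apply IHprv2].
    apply incl_cons; [apply in_eq | apply incl_tl, incl_map, I].
  - apply prv_eqI.
  - eapply prv_eqE; auto.
Qed.

(** Injectivity of [r] is asked for because identifying variables may turn a comprehension axiom
    into an unstratified instance. *)
Lemma prv_ren (G : list form) A : G ⊢ A -> forall r k, (forall n, k (r n) = n) ->
  map (ren r) G ⊢ ren r A.
Proof.
  induction 1; intros r k Hk; cbn [ren] in *.
  - apply prv_axiom; eauto using INF_ren.
  - apply prv_hyp, in_map, H.
  - eapply prv_botE, IHprv; eauto.
  - apply prv_andI; eauto.
  - eapply prv_andE1, IHprv; eauto.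
  - eapply prv_andE2, IHprv; eauto.
  - apply prv_orI1; eauto.
  - apply prv_orI2; eauto.
  - eapply prv_orE; [eapply IHprv1 | eapply IHprv2 | eapply IHprv3]; eauto.
  - apply prv_impI; eapply IHprv; eauto.
  - eapply prv_impE; eauto.
  - apply prv_allI. rewrite <- map_ren_shift. apply IHprv with (up k).
    intros [|n]; cbn; auto.
  - rewrite ren_inst. apply prv_allE; eauto.
  - apply prv_exI with (r t). rewrite <- ren_inst. eauto.
  - eapply prv_exE; [eapply IHprv1; eauto|].
    rewrite <- map_ren_shift, <- ren_shift. apply (IHprv2 _ (up k)).
    intros [|n]; cbn; auto.
  - apply prv_eqI.
  - rewrite ren_inst. eapply prv_eqE; [eapply IHprv1; eauto|].
    rewrite <- ren_inst. eauto.
Qed.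

(** In the next two rules the eigenvariable is a metavariable: it suffices to
    use the premise at a fresh [t], and to rename [t] to [0] injectively. *)

Definition unfresh (t n : nat) : nat := if n =? t then 0 else S n.

Lemma unfresh_inv t n : scons t (fun n => n) (unfresh t n) = n.
Proof. unfold unfresh; destruct (Nat.eqb_spec n t); cbn; auto. Qed.

Lemma unfresh_lt t n : n < t -> unfresh t n = S n.
Proof. unfold unfresh; destruct (Nat.eqb_spec n t); lia. Qed.

(** Take [t] beyond all free variables. On those variables [unfresh t] acts as the shift, and it
    sends [t] to [0], which undoes the instantiation. *)
Lemma fresh G A B : exists t,
  ren (unfresh t) (inst t A) = A /\ ren (unfresh t) B = shift B
  /\ map (ren (unfresh t)) G = map shift G.
Proof.
  destruct (fv_bound A) as [NA HA], (fv_bound B) as [NB HB],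
    (fv_bound_list G) as [NG HG].
  exists (NA + NB + NG). repeat split.
  - unfold inst. erewrite ren_ren by reflexivity.
    rewrite <- (ren_id A (fun n => n)) at 2 by auto. apply HA.
    intros [|n] Hn; cbn; [unfold unfresh; now rewrite Nat.eqb_refl|].
    apply unfresh_lt; lia.
  - apply HB; intros; apply unfresh_lt; lia.
  - apply HG; intros; apply unfresh_lt; lia.
Qed.

Lemma allI G A : (forall t, G ⊢ inst t A) -> G ⊢ All A.
Proof.
  intros H. destruct (fresh G A ⊥) as (t & HA & _ & HG).
  apply prv_allI. rewrite <- HG, <- HA.
  apply (prv_ren (H t) _ _ (unfresh_inv t)).
Qed.

Lemma exE G A B : G ⊢ Ex A ->
  (forall G' t, incl G G' -> G' ⊢ inst t A -> G' ⊢ B) -> G ⊢ B.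
Proof.
  intros HE H. destruct (fresh G A B) as (t & HA & HB & HG).
  apply prv_exE with A; auto. rewrite <- HG, <- HB, <- HA at 1.
  refine (prv_ren (G := inst t A :: G) _ _ _ (unfresh_inv t)).
  apply H with t; [apply incl_tl, incl_refl | apply prv_hyp, in_eq].
Qed.

(** As in [exE], the premise speaks of every larger context, so that proofs never display the list
    of hypotheses; [lift] carries earlier facts over to the new context. *)
Lemma impI G A B : (forall G', incl G G' -> G' ⊢ A -> G' ⊢ B) -> G ⊢ (A ⇒ B).
Proof.
  intros H. apply prv_impI, H; [apply incl_tl, incl_refl | apply prv_hyp, in_eq].
Qed.

Lemma orE G A B C : G ⊢ A ∨ B ->
  (forall G', incl G G' -> G' ⊢ A -> G' ⊢ C) ->
  (forall G', incl G G' -> G' ⊢ B -> G' ⊢ C) -> G ⊢ C.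
Proof.
  intros H HA HB.
  eapply prv_orE; [exact H | apply HA | apply HB];
    try (apply incl_tl, incl_refl); apply prv_hyp, in_eq.
Qed.

(** [env l] sends the free variables [0], [1], ... to the entries of [l]. *)
Fixpoint env (l : list nat) : nat -> nat :=
  match l with nil => fun n => n | t :: l => scons t (env l) end.

(** The map [env l] may identify variables, so [prv_ren] does not apply. Instead, the empty context
    allows generalising and instantiating one variable at a time. *)
Lemma prv_env l : forall G A, nil ⊢ A -> G ⊢ ren (env l) A.
Proof.
  induction l as [|t l IH]; intros G A H; cbn [env].
  - rewrite ren_id by reflexivity. apply (weak H). intros ? [].
  - rewrite <- (ren_ren A (up (env l)) (scons t (fun n => n)) _)
      by (intros [|n]; reflexivity).
    apply prv_allE. apply (IH G (All A)), prv_allI, H.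
Qed.

(** Stratification is checked while the parameters are still distinct variables; only then does [l]
    substitute the actual ones, which may coincide. *)
Lemma isset_ex A : stratified A -> forall l G,
  G ⊢ Ex (isset 0 (ren (up S) (ren (up (env l)) A))).
Proof.
  intros H l G.
  assert (HC : nil ⊢ comprehension A) by (apply prv_axiom, INF_comp, H).
  apply (prv_env l G) in HC.
  unfold comprehension, isset, Iff in *; cbn [ren] in HC.
  rewrite !(ren_ren A _ _ (up (fun n => S (env l n)))) in *; auto;
    intros [|n]; reflexivity.
Qed.

(** * Rules for the defined notions *)

Ltac lift I :=
  match type of I with incl ?G ?G' =>
    repeat match goal with H : G ⊢ _ |- _ => apply weak with (2 := I) in H end;
    clear I; try clear G
  end.

(** The defined notions commute with renaming by conversion. *)
Ltac ren1 M :=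
  match goal with |- context [ren ?r (M ?x)] =>
    change (ren r (M x)) with (M (r x)) end.
Ltac ren2 M :=
  match goal with |- context [ren ?r (M ?x ?y)] =>
    change (ren r (M x y)) with (M (r x) (r y)) end.
Ltac ren3 M :=
  match goal with |- context [ren ?r (M ?x ?y ?z)] =>
    change (ren r (M x y z)) with (M (r x) (r y) (r z)) end.
Ltac simp_ren :=
  repeat first
    [ progress cbn [inst ren up scons env Nat.add]
    | ren1 in_FUNC | ren1 is_id | ren1 is_zero | ren1 is_succ | ren1 is_relation
    | ren1 one_to_one | ren2 is_singleton | ren2 is_succ_of | ren2 is_domain
    | ren2 is_range | ren2 similar | ren2 subset | ren3 is_opair | ren3 opair_in
    | ren3 is_upair | ren3 is_Ap | ren3 is_succ_map | ren3 is_N ].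
Ltac simp H := unfold inst in H; revert H; simp_ren; intros H.

Ltac dest H :=
  lazymatch type of H with
  | _ ⊢ Ex _ =>
      eapply (exE H); clear H; let I := fresh "I" in let t := fresh "t" in
      let G' := fresh "G" in intros G' t I H; lift I; simp H; dest H
  | _ ⊢ _ ∧ _ =>
      let H' := fresh H in
      pose proof (prv_andE2 H) as H'; apply prv_andE1 in H; dest H; dest H'
  | _ => idtac
  end.

Ltac obtain L H :=
  match goal with |- ?G ⊢ _ => pose proof (L G) as H; dest H end.
Ltac imp H :=
  apply impI; let I := fresh "I" in let G' := fresh "G" in intros G' I H; lift I.
Ltac all x := apply allI; intros x; unfold inst; simp_ren.
Ltac ors H :=
  eapply (orE H); clear H; let I := fresh "I" in let G' := fresh "G" in
  intros G' I H; lift I.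
Ltac ands := repeat apply prv_andI.
Ltac ex t := apply prv_exI with t; unfold inst; simp_ren.

Lemma isset_intro G a A :
  (forall G' z, incl G G' -> G' ⊢ z ∈ a -> G' ⊢ inst z A) ->
  (forall G' z, incl G G' -> G' ⊢ inst z A -> G' ⊢ z ∈ a) ->
  G ⊢ isset a A.
Proof.
  intros H1 H2. apply allI; intros z. apply prv_andI; apply impI; intros G' I H.
  - apply H1; auto.
  - apply H2; auto.
Qed.

Lemma isset_in G a A z : G ⊢ isset a A -> G ⊢ inst z A -> G ⊢ z ∈ a.
Proof.
  intros H. apply prv_impE. apply (prv_andE2 (prv_allE z H)).
Qed.

Lemma in_isset G a A z : G ⊢ isset a A -> G ⊢ z ∈ a -> G ⊢ inst z A.
Proof.
  intros H. apply prv_impE. apply (prv_andE1 (prv_allE z H)).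
Qed.

Lemma set_ext G a b :
  (forall G' z, incl G G' -> G' ⊢ z ∈ a -> G' ⊢ z ∈ b) ->
  (forall G' z, incl G G' -> G' ⊢ z ∈ b -> G' ⊢ z ∈ a) ->
  G ⊢ a ≐ b.
Proof.
  intros H1 H2.
  assert (E : G ⊢ extensionality) by (apply prv_axiom, INF_ext).
  apply (prv_allE a), (prv_allE b) in E. refine (prv_impE E _).
  (* The premise of extensionality is, by conversion, that [a] is the set of all elements of [b]. *)
  apply (isset_intro (0 ∈ S b)); auto.
Qed.

Lemma isset_unique G a b A : G ⊢ isset a A -> G ⊢ isset b A -> G ⊢ a ≐ b.
Proof.
  intros Ha Hb. apply set_ext; intros G' z I Hz; lift I.
  - exact (isset_in z Hb (in_isset Ha Hz)).
  - exact (isset_in z Ha (in_isset Hb Hz)).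
Qed.

Lemma prv_sym G x y : G ⊢ x ≐ y -> G ⊢ y ≐ x.
Proof.
  intros E. exact (prv_eqE (0 ≐ S x) E (prv_eqI _ _ _)).
Qed.

Lemma prv_trans G x y z : G ⊢ x ≐ y -> G ⊢ y ≐ z -> G ⊢ x ≐ z.
Proof. intros E F. exact (prv_eqE (S x ≐ 0) F E). Qed.

Lemma eq_inl G x y a : G ⊢ x ≐ y -> G ⊢ x ∈ a -> G ⊢ y ∈ a.
Proof. intros E. exact (prv_eqE (0 ∈ S a) E). Qed.

Lemma eq_inr G x a b : G ⊢ a ≐ b -> G ⊢ x ∈ a -> G ⊢ x ∈ b.
Proof. intros E. exact (prv_eqE (S x ∈ 0) E). Qed.

(** ** Ordered pairs *)

Lemma singleton_in G s x y : G ⊢ is_singleton s x -> G ⊢ y ≐ x -> G ⊢ y ∈ s.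
Proof. intros Hs E. exact (isset_in y Hs E). Qed.

Lemma in_singleton G s x y : G ⊢ is_singleton s x -> G ⊢ y ∈ s -> G ⊢ y ≐ x.
Proof. intros Hs E. exact (in_isset Hs E). Qed.

Lemma upair_in1 G p x y : G ⊢ is_upair p x y -> G ⊢ x ∈ p.
Proof. intros Hp. exact (isset_in x Hp (prv_orI1 _ (prv_eqI _ _ _))). Qed.

Lemma upair_in2 G p x y : G ⊢ is_upair p x y -> G ⊢ y ∈ p.
Proof. intros Hp. exact (isset_in y Hp (prv_orI2 _ (prv_eqI _ _ _))). Qed.

Lemma in_upair G p x y z : G ⊢ is_upair p x y -> G ⊢ z ∈ p -> G ⊢ z ≐ x ∨ z ≐ y.
Proof. intros Hp E. exact (in_isset Hp E). Qed.

Lemma singleton_ex x G : G ⊢ Ex (is_singleton 0 (S x)).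
Proof.
  refine (isset_ex (A := 0 ≐ 1) _ (x :: nil) G).
  exists (fun _ => 0); reflexivity.
Qed.

Lemma upair_ex x y G : G ⊢ Ex (is_upair 0 (S x) (S y)).
Proof.
  refine (isset_ex (A := 0 ≐ 1 ∨ 0 ≐ 2) _ (x :: y :: nil) G).
  exists (fun _ => 0); split; reflexivity.
Qed.

Lemma opair_ex x y G : G ⊢ Ex (is_opair 0 (S x) (S y)).
Proof.
  obtain (singleton_ex x) Hs. obtain (upair_ex x y) Hp. obtain (upair_ex t t0) Hu.
  ex t1. ex t. ex t0. ands; assumption.
Qed.

(** The element {x} of [u] is {x'} or {x',y'}. In the first case x lies in {x'}, in the second x'
    lies in {x}. *)
Lemma opair_inj1 G u x y x' y' :
  G ⊢ is_opair u x y -> G ⊢ is_opair u x' y' -> G ⊢ x ≐ x'.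
Proof.
  intros H H'. unfold is_opair in H, H'. dest H. dest H'.
  pose proof (in_upair H'1 (upair_in1 H1)) as E. ors E.
  - eapply in_singleton; [exact H'|]. eapply eq_inr; [exact E|].
    eapply singleton_in; [exact H|]. apply prv_eqI.
  - apply prv_sym. eapply in_singleton; [exact H|].
    eapply eq_inr; [exact (prv_sym E)|]. eapply upair_in1; eassumption.
Qed.

(** The case [y = x] is symmetric in [y] and [y'], so that no decision whether the
    pairs are degenerate is needed. *)
Lemma opair_inj2 G u x y x' y' :
  G ⊢ is_opair u x y -> G ⊢ is_opair u x' y' -> G ⊢ y ≐ y'.
Proof.
  intros H H'. pose proof (opair_inj1 H H') as Ex.
  assert (Ors : forall G u x y x' y', G ⊢ is_opair u x y -> G ⊢ is_opair u x' y' ->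
    G ⊢ y ≐ x' ∨ y ≐ y').
  { clear. intros G u x y x' y' H H'. unfold is_opair in H, H'. dest H. dest H'.
    pose proof (in_upair H'1 (upair_in2 H1)) as E. ors E.
    - apply prv_orI1. eapply in_singleton; [exact H'|]. eapply eq_inr; [exact E|].
      eapply upair_in2; eassumption.
    - eapply in_upair; [exact H'0|]. eapply eq_inr; [exact E|].
      eapply upair_in2; eassumption. }
  pose proof (Ors _ _ _ _ _ _ H H') as E. ors E; [|exact E].
  pose proof (Ors _ _ _ _ _ _ H' H) as E'. ors E'; [|exact (prv_sym E')].
  exact (prv_trans E (prv_trans (prv_sym Ex) (prv_sym E'))).
Qed.

Lemma opair_in_intro G u x y f : G ⊢ is_opair u x y -> G ⊢ u ∈ f -> G ⊢ opair_in x y f.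
Proof. intros Hu Hf. ex u. ands; assumption. Qed.

Lemma opair_in_eq G x x' y y' f f' : G ⊢ x ≐ x' -> G ⊢ y ≐ y' -> G ⊢ f ≐ f' ->
  G ⊢ opair_in x y f -> G ⊢ opair_in x' y' f'.
Proof.
  intros Ex Ey Ef H.
  refine (prv_eqE (opair_in 0 (S y') (S f')) Ex _).
  refine (prv_eqE (opair_in (S x) 0 (S f')) Ey _).
  exact (prv_eqE (opair_in (S x) (S y) 0) Ef H).
Qed.

(** ** Functions and application *)

Lemma FUNC_intro G f :
  (forall G' x y z, incl G G' -> G' ⊢ opair_in x y f -> G' ⊢ opair_in x z f ->
    G' ⊢ y ≐ z) -> G ⊢ in_FUNC f.
Proof.
  intros H. all x. all y. all z. apply impI; intros G1 I1 H1.
  apply impI; intros G2 I2 H2. pose proof (incl_tran I1 I2) as I. lift I2.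
  apply H with x; assumption.
Qed.

Lemma FUNC_elim G f x y z : G ⊢ in_FUNC f -> G ⊢ opair_in x y f ->
  G ⊢ opair_in x z f -> G ⊢ y ≐ z.
Proof.
  intros H Hy. apply prv_impE. refine (prv_impE _ Hy).
  exact (prv_allE z (prv_allE y (prv_allE x H))).
Qed.

Lemma FUNC_eq G f g : G ⊢ f ≐ g -> G ⊢ in_FUNC f -> G ⊢ in_FUNC g.
Proof. intros E. exact (prv_eqE (in_FUNC 0) E). Qed.

Lemma Ap_intro G f x y : G ⊢ in_FUNC f -> G ⊢ opair_in x y f -> G ⊢ is_Ap y f x.
Proof.
  intros Hf H. apply isset_intro; intros G' z I Hz; lift I; simp Hz.
  - ex y. ands; assumption.
  - dest Hz. eapply eq_inr; [|exact Hz0]. eapply FUNC_elim; eassumption.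
Qed.

Lemma Ap_unique G f x y r : G ⊢ in_FUNC f -> G ⊢ opair_in x y f -> G ⊢ is_Ap r f x ->
  G ⊢ r ≐ y.
Proof. intros Hf H Hr. eapply isset_unique, Ap_intro; eassumption. Qed.

(** * Church numbers *)

Lemma in_id G i u : G ⊢ is_id i -> G ⊢ u ∈ i -> G ⊢ Ex (is_opair (S u) 0 0).
Proof.
  intros Hi Hu. pose proof (in_isset Hi Hu) as H. simp H. dest H. ex t. assumption.
Qed.

Lemma id_intro G i x : G ⊢ is_id i -> G ⊢ opair_in x x i.
Proof.
  intros Hi. obtain (opair_ex x x) H.
  eapply opair_in_intro; [exact H|]. apply (isset_in _ Hi). simp_ren.
  ex x. ands; [apply prv_eqI | assumption].
Qed.

Lemma id_elim G i x y : G ⊢ is_id i -> G ⊢ opair_in x y i -> G ⊢ x ≐ y.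
Proof.
  intros Hi H. unfold opair_in in H. dest H.
  pose proof (in_id Hi H0) as Hu. dest Hu.
  exact (prv_trans (opair_inj1 H Hu) (prv_sym (opair_inj2 H Hu))).
Qed.

Lemma id_FUNC G i : G ⊢ is_id i -> G ⊢ in_FUNC i.
Proof.
  intros Hi. apply FUNC_intro; intros G' x y z I Hy Hz; lift I.
  exact (prv_trans (prv_sym (id_elim Hi Hy)) (id_elim Hi Hz)).
Qed.

Lemma id_eq G i j : G ⊢ i ≐ j -> G ⊢ is_id i -> G ⊢ is_id j.
Proof. intros E. exact (prv_eqE (is_id 0) E). Qed.

Lemma zero_intro G o f i : G ⊢ is_zero o -> G ⊢ is_id i -> G ⊢ opair_in f i o.
Proof.
  intros Ho Hi. obtain (opair_ex f i) H.
  eapply opair_in_intro; [exact H|]. apply (isset_in _ Ho). simp_ren.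
  ex f. ands; [apply prv_eqI|]. ex i. ands; assumption.
Qed.

Lemma zero_elim G o f i : G ⊢ is_zero o -> G ⊢ opair_in f i o -> G ⊢ is_id i.
Proof.
  intros Ho H. unfold opair_in in H. dest H.
  pose proof (in_isset Ho H0) as Hu. simp Hu. dest Hu.
  eapply id_eq; [|exact Hu0]. exact (opair_inj2 Hu1 H).
Qed.

Lemma zero_FUNC G o : G ⊢ is_zero o -> G ⊢ in_FUNC o.
Proof.
  intros Ho. apply FUNC_intro; intros G' x y z I Hy Hz; lift I.
  eapply isset_unique; [exact (zero_elim Ho Hy) | exact (zero_elim Ho Hz)].
Qed.

Lemma succ_map_intro G p f z x w t q :
  G ⊢ is_succ_map p f z -> G ⊢ in_FUNC t -> G ⊢ opair_in f t z ->
  G ⊢ opair_in x q t -> G ⊢ opair_in q w f -> G ⊢ opair_in x w p.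
Proof.
  intros Hp Ht Hf Hx Hq. obtain (opair_ex x w) H.
  eapply opair_in_intro; [exact H|]. apply (isset_in _ Hp). simp_ren.
  ex x. ex w. ex t. ex q. ands; assumption.
Qed.

Lemma succ_map_elim G p f z x w :
  G ⊢ is_succ_map p f z -> G ⊢ opair_in x w p ->
  G ⊢ Ex (Ex (in_FUNC 1 ∧ opair_in (2 + f) 1 (2 + z) ∧ opair_in (2 + x) 0 1
              ∧ opair_in 0 (2 + w) (2 + f))).
Proof.
  intros Hp H. unfold opair_in in H. dest H.
  pose proof (in_isset Hp H0) as Hu. simp Hu. dest Hu.
  pose proof (opair_inj1 Hu H) as Ex. pose proof (opair_inj2 Hu H) as Ew.
  ex t2. ex t3. ands; [assumption | assumption | |].
  - exact (opair_in_eq Ex (prv_eqI _ _ _) (prv_eqI _ _ _) Hu2).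
  - exact (opair_in_eq (prv_eqI _ _ _) Ew (prv_eqI _ _ _) Hu3).
Qed.

(** Uniqueness passes along the chain: [z] determines the inner function, that function the
    intermediate value, and [f] the final value. *)
Lemma succ_map_FUNC G p f z :
  G ⊢ is_succ_map p f z -> G ⊢ in_FUNC z -> G ⊢ in_FUNC f -> G ⊢ in_FUNC p.
Proof.
  intros Hp Hz Hf. apply FUNC_intro; intros G' x w w' I Hw Hw'; lift I.
  pose proof (succ_map_elim Hp Hw) as H; dest H.
  pose proof (succ_map_elim Hp Hw') as H'; dest H'.
  pose proof (FUNC_elim Hz H'0 H0) as Et.
  pose proof (FUNC_elim H
    (opair_in_eq (prv_eqI _ _ _) (prv_eqI _ _ _) Et H'1) H1) as Eq.
  exact (FUNC_elim Hf H2 (opair_in_eq Eq (prv_eqI _ _ _) (prv_eqI _ _ _) H'2)).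
Qed.

Lemma succ_map_eq G p p' f f' z :
  G ⊢ p ≐ p' -> G ⊢ f ≐ f' -> G ⊢ is_succ_map p f z -> G ⊢ is_succ_map p' f' z.
Proof.
  intros Ep Ef H. refine (prv_eqE (is_succ_map 0 (S f') (S z)) Ep _).
  exact (prv_eqE (is_succ_map (S p) 0 (S z)) Ef H).
Qed.

Lemma succ_of_intro G a z f p :
  G ⊢ is_succ_of a z -> G ⊢ in_FUNC f -> G ⊢ is_succ_map p f z ->
  G ⊢ opair_in f p a.
Proof.
  intros Ha Hf Hp. obtain (opair_ex f p) H.
  eapply opair_in_intro; [exact H|]. apply (isset_in _ Ha). simp_ren.
  ex f. ex p. ands; assumption.
Qed.

Lemma succ_of_elim G a z f p :
  G ⊢ is_succ_of a z -> G ⊢ opair_in f p a -> G ⊢ in_FUNC f ∧ is_succ_map p f z.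
Proof.
  intros Ha H. unfold opair_in in H. dest H.
  pose proof (in_isset Ha H0) as Hu. simp Hu. dest Hu.
  pose proof (opair_inj1 Hu H) as Ef. pose proof (opair_inj2 Hu H) as Ep.
  ands; [eapply FUNC_eq | eapply succ_map_eq]; eassumption.
Qed.

Lemma succ_of_FUNC G a z : G ⊢ is_succ_of a z -> G ⊢ in_FUNC a.
Proof.
  intros Ha. apply FUNC_intro; intros G' f p p' I Hp Hp'; lift I.
  eapply isset_unique;
    [exact (prv_andE2 (succ_of_elim Ha Hp)) | exact (prv_andE2 (succ_of_elim Ha Hp'))].
Qed.

Lemma succ_of_eq G a a' z z' :
  G ⊢ a ≐ a' -> G ⊢ z ≐ z' -> G ⊢ is_succ_of a z -> G ⊢ is_succ_of a' z'.
Proof.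
  intros Ea Ez H. refine (prv_eqE (is_succ_of 0 (S z')) Ea _).
  exact (prv_eqE (is_succ_of (S a) 0) Ez H).
Qed.

Lemma succ_intro G s a z :
  G ⊢ is_succ s -> G ⊢ in_FUNC z -> G ⊢ is_succ_of a z -> G ⊢ opair_in z a s.
Proof.
  intros Hs Hz Ha. obtain (opair_ex z a) H.
  eapply opair_in_intro; [exact H|]. apply (isset_in _ Hs). simp_ren.
  ex z. ex a. ands; assumption.
Qed.

Lemma succ_elim G s a z :
  G ⊢ is_succ s -> G ⊢ opair_in z a s -> G ⊢ in_FUNC z ∧ is_succ_of a z.
Proof.
  intros Hs H. unfold opair_in in H. dest H.
  pose proof (in_isset Hs H0) as Hu. simp Hu. dest Hu.
  pose proof (opair_inj1 Hu H) as Ez. pose proof (opair_inj2 Hu H) as Ea.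
  ands; [eapply FUNC_eq | eapply succ_of_eq]; eassumption.
Qed.

Lemma succ_FUNC G s : G ⊢ is_succ s -> G ⊢ in_FUNC s.
Proof.
  intros Hs. apply FUNC_intro; intros G' z a a' I Ha Ha'; lift I.
  eapply isset_unique;
    [exact (prv_andE2 (succ_elim Hs Ha)) | exact (prv_andE2 (succ_elim Hs Ha'))].
Qed.

(** ** Existence of the sets used *)

(** The indices of bound variables are left open and found by unification. A pair lies two levels
    above its components and a relation three: with arguments x, w at level 0, functions are at 3,
    Church numbers at 6 and the successor at 9. *)
Ltac strat :=
  unfold is_N, is_succ, is_succ_of, is_succ_map, is_zero, is_id, is_Ap,
    in_FUNC, opair_in, is_opair, is_upair, is_singleton, isset, Iff;
  cbn; repeat first [reflexivity | exact I | apply conj | eexists];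
  try exact 0.

Lemma id_ex G : G ⊢ Ex (is_id 0).
Proof.
  refine (isset_ex (A := Ex (0 ≐ 0 ∧ is_opair 1 0 0)) _ nil G).
  unshelve eexists (fun _ => 2). strat.
Qed.

Lemma zero_ex G : G ⊢ Ex (is_zero 0).
Proof.
  refine (isset_ex (A := Ex (0 ≐ 0 ∧ Ex (is_id 0 ∧ is_opair 2 1 0))) _ nil G).
  unshelve eexists (fun _ => 5). strat.
Qed.

Lemma succ_map_ex f z G : G ⊢ Ex (is_succ_map 0 (S f) (S z)).
Proof.
  refine (isset_ex (A := Ex (Ex (Ex (Ex (
    is_opair 4 3 2 ∧ in_FUNC 1 ∧ opair_in 5 1 6
    ∧ opair_in 3 0 1 ∧ opair_in 0 2 5))))) _ (f :: z :: nil) G).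
  exists (scons 2 (scons 3 (fun _ => 6))). strat.
Qed.

Lemma succ_of_ex z G : G ⊢ Ex (is_succ_of 0 (S z)).
Proof.
  refine (isset_ex (A := Ex (Ex (is_opair 2 1 0 ∧ in_FUNC 1 ∧ is_succ_map 0 1 3)))
    _ (z :: nil) G).
  exists (scons 5 (fun _ => 6)). strat.
Qed.

Lemma succ_ex G : G ⊢ Ex (is_succ 0).
Proof.
  refine (isset_ex (A := Ex (Ex (is_opair 2 1 0 ∧ in_FUNC 1 ∧ is_succ_of 0 1)))
    _ nil G).
  exists (fun _ => 8). strat.
Qed.

Lemma N_ex o s G : G ⊢ Ex (is_N 0 (S o) (S s)).
Proof.
  refine (isset_ex (A := All (
    2 ∈ 0 ∧ All (0 ∈ 1 ⇒ Ex (is_Ap 0 5 1 ∧ 0 ∈ 2)) ⇒ 1 ∈ 0))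
    _ (o :: s :: nil) G).
  exists (scons 6 (scons 6 (fun _ => 9))). strat.
Qed.

(** ** Induction *)

Lemma zero_N G n o s : G ⊢ is_N n o s -> G ⊢ o ∈ n.
Proof.
  intros Hn. apply (isset_in _ Hn). simp_ren. all X. imp H.
  exact (prv_andE1 H).
Qed.

Lemma N_ind G n o s X x : G ⊢ is_N n o s -> G ⊢ o ∈ X ->
  (forall G' y, incl G G' -> G' ⊢ y ∈ X ->
     G' ⊢ Ex (is_Ap 0 (S s) (S y) ∧ 0 ∈ S X)) ->
  G ⊢ x ∈ n -> G ⊢ x ∈ X.
Proof.
  intros Hn Ho HX Hx. pose proof (prv_allE X (in_isset Hn Hx)) as H.
  refine (prv_impE H (prv_andI Ho _)).
  apply allI; intros y. apply impI. intros G' I Hy. exact (HX G' y I Hy).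
Qed.

Lemma succ_N G n o s x a : G ⊢ is_N n o s -> G ⊢ is_succ s -> G ⊢ x ∈ n ->
  G ⊢ opair_in x a s -> G ⊢ a ∈ n.
Proof.
  intros Hn Hs Hx Ha. apply (isset_in _ Hn). simp_ren. all X. imp H.
  pose proof (prv_impE (prv_allE X (in_isset Hn Hx)) H) as HX.
  pose proof (prv_impE (prv_allE x (prv_andE2 H)) HX) as Hr. simp Hr. dest Hr.
  eapply eq_inl; [exact (Ap_unique (succ_FUNC Hs) Ha Hr) | assumption].
Qed.

(** * Delayed iteration of the successor *)

Definition is_V (a : nat) : form := isset a (0 ≐ 0).

Lemma V_ex G : G ⊢ Ex (is_V 0).
Proof.
  refine (isset_ex (A := 0 ≐ 0) _ nil G). exists (fun _ => 0); reflexivity.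
Qed.

Lemma in_V G a x : G ⊢ is_V a -> G ⊢ x ∈ a.
Proof. intros Ha. exact (isset_in x Ha (prv_eqI _ _ _)). Qed.

Lemma empty_ex G : G ⊢ Ex (isset 0 ⊥).
Proof. refine (isset_ex (A := ⊥) _ nil G). exists (fun _ => 0); exact I. Qed.

(** The universe contains every pair. As a function it would give [a] both the empty set and [a]
    itself as values, but [a] has an element. *)
Lemma V_not_FUNC G a : G ⊢ is_V a -> G ⊢ in_FUNC a -> G ⊢ ⊥.
Proof.
  intros Ha Hf. obtain empty_ex He.
  assert (Hp : forall G y, G ⊢ is_V a -> G ⊢ opair_in a y a).
  { clear. intros G y Ha. obtain (opair_ex a y) H.
    eapply opair_in_intro; [exact H|]. apply in_V, Ha. }
  refine (in_isset (A := ⊥) (z := a) He _). eapply eq_inr; [|exact (in_V a Ha)].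
  eapply FUNC_elim; [exact Hf | |]; apply Hp; assumption.
Qed.

Definition is_delay (f s a o : nat) : form :=
  isset f (0 ∈ S s ∨ is_opair 0 (S a) (S o)).

Lemma delay_ex s a o G : G ⊢ Ex (is_delay 0 (S s) (S a) (S o)).
Proof.
  refine (isset_ex (A := 0 ∈ 1 ∨ is_opair 0 2 3) _ (s :: a :: o :: nil) G).
  exists (scons 2 (scons 3 (fun _ => 0))). strat.
Qed.

Lemma delay_new G f s a o : G ⊢ is_delay f s a o -> G ⊢ opair_in a o f.
Proof.
  intros Hf. obtain (opair_ex a o) H. eapply opair_in_intro; [exact H|].
  apply (isset_in _ Hf). simp_ren. apply prv_orI2, H.
Qed.

Lemma delay_old G f s a o x y : G ⊢ is_delay f s a o -> G ⊢ opair_in x y s ->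
  G ⊢ opair_in x y f.
Proof.
  intros Hf H. unfold opair_in in H. dest H. eapply opair_in_intro; [exact H|].
  apply (isset_in _ Hf). simp_ren. apply prv_orI1, H0.
Qed.

Lemma delay_elim G f s a o x y : G ⊢ is_delay f s a o -> G ⊢ opair_in x y f ->
  G ⊢ opair_in x y s ∨ (x ≐ a ∧ y ≐ o).
Proof.
  intros Hf H. unfold opair_in in H. dest H.
  pose proof (in_isset Hf H0) as Hu. simp Hu. ors Hu.
  - apply prv_orI1. eapply opair_in_intro; eassumption.
  - apply prv_orI2. ands; [eapply opair_inj1 | eapply opair_inj2]; eassumption.
Qed.

(** Membership in [f] yields a disjunction, so the case split is intuitionistic. The mixed cases
    would put V into FUNC. *)
Lemma delay_FUNC G f s a o : G ⊢ is_delay f s a o -> G ⊢ is_succ s -> G ⊢ is_V a ->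
  G ⊢ in_FUNC f.
Proof.
  intros Hf Hs Ha. apply FUNC_intro; intros G' x y z I Hy Hz; lift I.
  pose proof (delay_elim Hf Hy) as Ey. pose proof (delay_elim Hf Hz) as Ez.
  ors Ey; ors Ez.
  - exact (FUNC_elim (succ_FUNC Hs) Ey Ez).
  - apply prv_botE, (V_not_FUNC Ha).
    exact (FUNC_eq (prv_andE1 Ez) (prv_andE1 (succ_elim Hs Ey))).
  - apply prv_botE, (V_not_FUNC Ha).
    exact (FUNC_eq (prv_andE1 Ey) (prv_andE1 (succ_elim Hs Ez))).
  - exact (prv_trans (prv_andE2 Ey) (prv_sym (prv_andE2 Ez))).
Qed.

(** With w, t, t', q for [3], [2], [1], [0]: [t] is j(s), [t'] is j(f), and
    (f ∘ t') a = w = t o.  Inlining f ∘ t' instead of mentioning the successor of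
    [j] keeps the formula stratified. *)
Definition delayed (j s a o f : nat) : form :=
  in_FUNC j ∧ Ex (Ex (Ex (Ex (
    in_FUNC 3 ∧ in_FUNC 2 ∧ in_FUNC 1
    ∧ opair_in (4 + s) 2 (4 + j) ∧ opair_in (4 + o) 3 2
    ∧ opair_in (4 + f) 1 (4 + j) ∧ opair_in (4 + a) 0 1 ∧ opair_in 0 3 (4 + f))))).

(** The variable [j] is applied to [s] at level 9 and so lies at 12, while the value j s o is at 6.
    Hence j s o = j is unstratified: the induction only compares the two iterations, and the
    counting axiom enters afterwards. *)
Lemma delayed_set_ex s a o f G :
  G ⊢ Ex (isset 0 (delayed 0 (2 + s) (2 + a) (2 + o) (2 + f))).
Proof.
  refine (isset_ex (A := delayed 0 1 2 3 4) _ (s :: a :: o :: f :: nil) G).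
  exists (scons 12 (scons 9 (scons 6 (scons 6 (fun _ => 9))))).
  unfold delayed. strat.
Qed.

Lemma delayed_zero G s a o f :
  G ⊢ is_delay f s a o -> G ⊢ is_zero o -> G ⊢ delayed o s a o f.
Proof.
  intros Hf Ho. obtain id_ex Hi. ands; [exact (zero_FUNC Ho)|].
  (* Zero sends both [s] and [f] to the identity [t], so w is [o], q is [a], and the last conjunct
     is the added pair ⟨a,o⟩. *)
  ex o. ex t. ex t. ex a.
  ands; auto using zero_FUNC, id_FUNC, zero_intro, id_intro.
  eapply delay_new; eassumption.
Qed.

(** The new functions are s ∘ t and f ∘ t'. The new q is the old w, and the new w is its successor;
    [f] agrees with [s] there because w is in FUNC. *)
Lemma delayed_succ G s a o f x y :
  G ⊢ is_delay f s a o -> G ⊢ is_succ s -> G ⊢ is_V a ->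
  G ⊢ delayed x s a o f -> G ⊢ is_succ_of y x -> G ⊢ delayed y s a o f.
Proof.
  intros Hf Hs Ha Hx Hy.
  pose proof (delay_FUNC Hf Hs Ha) as Ff. pose proof (succ_FUNC Hs) as Fs.
  unfold delayed in Hx. dest Hx. rename t into w, t0 into t, t1 into t', t2 into q.
  obtain (succ_of_ex w) Hw'. obtain (succ_map_ex s x) Hp. obtain (succ_map_ex f x) Hp'.
  rename t0 into w', t1 into p, t2 into p'.
  assert (Hww : forall G, G ⊢ is_succ s -> G ⊢ in_FUNC w -> G ⊢ is_succ_of w' w ->
    G ⊢ opair_in w w' s) by (intros; apply succ_intro; assumption).
  ands; [exact (succ_of_FUNC Hy)|].
  ex w'. ex p. ex p'. ex w. ands.
  - exact (succ_of_FUNC Hw').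
  - eapply succ_map_FUNC; eassumption.
  - eapply succ_map_FUNC; eassumption.
  - eapply succ_of_intro; eassumption.
  - eapply succ_map_intro with (t := t) (q := w); eauto.
  - eapply succ_of_intro; eassumption.
  - eapply succ_map_intro with (t := t') (q := q); eassumption.
  - eapply delay_old; eauto.
Qed.

Lemma delayed_N G n s a o f x :
  G ⊢ is_delay f s a o -> G ⊢ is_zero o -> G ⊢ is_succ s -> G ⊢ is_V a ->
  G ⊢ is_N n o s -> G ⊢ x ∈ n -> G ⊢ delayed x s a o f.
Proof.
  intros Hf Ho Hs Ha Hn Hx. obtain (delayed_set_ex s a o f) HX.
  refine (in_isset HX _). eapply N_ind; [exact Hn | | | exact Hx].
  - exact (isset_in _ HX (delayed_zero Hf Ho)).
  - intros G' y I Hy; lift I. pose proof (in_isset HX Hy) as Hd.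
    change (G' ⊢ delayed y s a o f) in Hd.
    obtain (succ_of_ex y) Hb. ex t0. ands.
    + apply Ap_intro; [exact (succ_FUNC Hs)|].
      exact (succ_intro Hs (prv_andE1 Hd) Hb).
    + exact (isset_in _ HX (delayed_succ Hf Hs Ha Hd Hb)).
Qed.

(** Functionality is the first conjunct of [delayed], so it comes out of the same induction. *)
Lemma N_FUNC G n o s x :
  G ⊢ is_zero o -> G ⊢ is_succ s -> G ⊢ is_N n o s -> G ⊢ x ∈ n -> G ⊢ in_FUNC x.
Proof.
  intros Ho Hs Hn Hx. obtain V_ex Ha. obtain (delay_ex s t o) Hf.
  exact (prv_andE1 (delayed_N Hf Ho Hs Ha Hn Hx)).
Qed.

(** * Injectivity of successor from the counting axiom *)

Lemma church_counting_elim G n s o x :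
  G ⊢ church_counting n s o -> G ⊢ x ∈ n ->
  G ⊢ Ex (is_Ap 0 (S x) (S s) ∧ is_Ap (S x) 0 (S o)).
Proof.
  intros HC Hx. pose proof (prv_impE (prv_allE x HC) Hx) as H. simp H. dest H.
  ex t. ands; [assumption|].
  exact (prv_eqE (is_Ap 0 (S t) (S o)) H1 H0).
Qed.

(** (x+1)(f)(a) = x(s)(o) = x *)
Lemma delay_counting G n s a o f x y :
  G ⊢ church_counting n s o ->
  G ⊢ is_delay f s a o -> G ⊢ is_zero o -> G ⊢ is_succ s -> G ⊢ is_V a ->
  G ⊢ is_N n o s -> G ⊢ x ∈ n -> G ⊢ is_succ_of y x ->
  G ⊢ Ex (opair_in (S f) 0 (S y) ∧ in_FUNC 0 ∧ opair_in (S a) (S x) 0).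
Proof.
  intros HC Hf Ho Hs Ha Hn Hx Hy.
  pose proof (delay_FUNC Hf Hs Ha) as Ff.
  pose proof (delayed_N Hf Ho Hs Ha Hn Hx) as Hd. unfold delayed in Hd. dest Hd.
  pose proof (church_counting_elim HC Hx) as H. dest H.
  obtain (succ_map_ex f x) Hp.
  assert (Ex : forall G, G ⊢ in_FUNC x -> G ⊢ in_FUNC t0 -> G ⊢ opair_in s t0 x ->
    G ⊢ opair_in o t t0 -> G ⊢ is_Ap t3 x s -> G ⊢ is_Ap x t3 o -> G ⊢ t ≐ x).
  { clear. intros G Fx Ft Hs Ho H H'. apply prv_sym.
    apply (Ap_unique Ft Ho).
    exact (prv_eqE (is_Ap (S x) 0 (S o)) (Ap_unique Fx Hs H) H'). }
  (* The witness [t4] is f ∘ t', the value of [y] at [f]; it sends [a] to w, which is [x] by the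
     counting axiom. *)
  ex t4. ands.
  - eapply succ_of_intro; eassumption.
  - eapply succ_map_FUNC; eassumption.
  - eapply succ_map_intro; try eassumption.
    eapply opair_in_eq; [apply prv_eqI | | apply prv_eqI | eassumption].
    auto.
Qed.

(** The common successor [z], applied to the delay function and then to V, yields [x] and also
    [y]. *)
Lemma counting_inj G n s o x y z :
  G ⊢ church_counting n s o ->
  G ⊢ is_zero o -> G ⊢ is_succ s -> G ⊢ is_N n o s ->
  G ⊢ x ∈ n -> G ⊢ y ∈ n -> G ⊢ opair_in x z s -> G ⊢ opair_in y z s -> G ⊢ x ≐ y.
Proof.
  intros HC Ho Hs Hn Hx Hy Hxz Hyz.
  obtain V_ex Ha. obtain (delay_ex s t o) Hf.
  pose proof (prv_andE2 (succ_elim Hs Hxz)) as Sx.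
  pose proof (prv_andE2 (succ_elim Hs Hyz)) as Sy.
  pose proof (delay_counting HC Hf Ho Hs Ha Hn Hx Sx) as H.
  pose proof (delay_counting HC Hf Ho Hs Ha Hn Hy Sy) as H'. dest H. dest H'.
  eapply FUNC_elim; [exact H0 | exact H1 |].
  eapply opair_in_eq; [apply prv_eqI | apply prv_eqI | | exact H'1].
  exact (FUNC_elim (succ_of_FUNC Sx) H' H).
Qed.

(** For the empty function e, zero yields the identity, which contains ⟨e,e⟩. If zero were a
    successor, this pair would arise from a final step ⟨q,e⟩ in e. *)
Lemma zero_not_succ G o s x y :
  G ⊢ is_zero o -> G ⊢ is_succ s -> G ⊢ opair_in x y s -> G ⊢ y ≐ o -> G ⊢ ⊥.
Proof.
  intros Ho Hs H E. obtain empty_ex He. rename t into e. obtain id_ex Hi.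
  assert (H1 : forall G u, G ⊢ isset e ⊥ -> G ⊢ u ∈ e -> G ⊢ ⊥)
    by (intros ? ? He'; exact (in_isset He')).
  pose proof (zero_intro e Ho Hi) as Hz.
  pose proof (opair_in_eq (prv_eqI _ _ e) (prv_eqI _ _ t) (prv_sym E) Hz) as Hy.
  pose proof (succ_of_elim (prv_andE2 (succ_elim Hs H)) Hy) as Hp. dest Hp.
  pose proof (succ_map_elim Hp0 (id_intro e Hi)) as Hm. dest Hm.
  unfold opair_in in Hm2. dest Hm2. eapply H1; eassumption.
Qed.

(** ** Infinity *)

Definition is_restriction (r s n : nat) : form :=
  isset r (Ex (Ex (is_opair 2 1 0 ∧ 1 ∈ 3 + n ∧ opair_in 1 0 (3 + s)))).

Lemma restriction_ex s n G : G ⊢ Ex (is_restriction 0 (S s) (S n)).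
Proof.
  refine (isset_ex (A := Ex (Ex (is_opair 2 1 0 ∧ 1 ∈ 4 ∧ opair_in 1 0 3))) _
    (s :: n :: nil) G).
  exists (scons 5 (scons 6 (fun _ => 4))). strat.
Qed.

Lemma range_ex r G : G ⊢ Ex (is_range 0 (S r)).
Proof.
  refine (isset_ex (A := Ex (opair_in 0 1 2)) _ (r :: nil) G).
  exists (scons 5 (fun _ => 8)). strat.
Qed.

Lemma restriction_intro G r s n x y :
  G ⊢ is_restriction r s n -> G ⊢ x ∈ n -> G ⊢ opair_in x y s -> G ⊢ opair_in x y r.
Proof.
  intros Hr Hx H. obtain (opair_ex x y) Hu.
  eapply opair_in_intro; [exact Hu|]. apply (isset_in _ Hr). simp_ren.
  ex x. ex y. ands; assumption.
Qed.

Lemma restriction_elim G r s n x y :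
  G ⊢ is_restriction r s n -> G ⊢ opair_in x y r -> G ⊢ x ∈ n ∧ opair_in x y s.
Proof.
  intros Hr H. unfold opair_in in H. dest H.
  pose proof (in_isset Hr H0) as Hu. simp Hu. dest Hu.
  ands.
  - eapply eq_inl; [exact (opair_inj1 Hu H) | assumption].
  - eapply opair_in_eq; [exact (opair_inj1 Hu H) | exact (opair_inj2 Hu H)
      | apply prv_eqI | assumption].
Qed.

(** The proper subset is the range of the successor restricted to ℕ, and the restriction itself is
    the bijection. *)
Lemma infinite_N G n s o :
  G ⊢ church_counting n s o -> G ⊢ is_zero o -> G ⊢ is_succ s -> G ⊢ is_N n o s ->
  G ⊢ infinite n.
Proof.
  intros HC Ho Hs Hn. obtain (restriction_ex s n) Hr. rename t into r.
  match type of Hr with ?G ⊢ _ => change (G ⊢ is_restriction r s n) in Hr end.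
  obtain (range_ex r) HY. rename t into Y.
  ex Y. ands.
  - all y. imp H. pose proof (in_isset HY H) as Hy. simp Hy. dest Hy.
    pose proof (restriction_elim Hr Hy) as Hx. dest Hx.
    eapply succ_N; eassumption.
  (* If the range were all of ℕ, it would contain zero. *)
  - imp E. pose proof (in_isset HY (eq_inr (prv_sym E) (zero_N Hn))) as Hy.
    simp Hy. dest Hy.
    pose proof (restriction_elim Hr Hy) as Hx. dest Hx.
    eapply zero_not_succ; try eassumption. apply prv_eqI.
  - ex r. ands.
    + all u. imp Hu. pose proof (in_isset Hr Hu) as H. simp H. dest H.
      ex t. ex t0. assumption.
    + apply FUNC_intro; intros G' x y z I Hy Hz; lift I.
      exact (FUNC_elim (succ_FUNC Hs) (prv_andE2 (restriction_elim Hr Hy))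
        (prv_andE2 (restriction_elim Hr Hz))).
    + all x. all y. all z. imp Hx. imp Hy.
      pose proof (restriction_elim Hr Hx) as Hx'. dest Hx'.
      pose proof (restriction_elim Hr Hy) as Hy'. dest Hy'.
      eapply counting_inj; eassumption.
    + apply isset_intro; intros G' x I H; lift I; simp H; unfold inst; simp_ren.
      (* The domain of [s] is FUNC, so that it covers ℕ rests on [N_FUNC]. *)
      * obtain (succ_of_ex x) Ha. ex t.
        eapply restriction_intro; try eassumption.
        eapply succ_intro; try eassumption. eapply N_FUNC; eassumption.
      * dest H. exact (prv_andE1 (restriction_elim Hr H)).
    + exact HY.
Qed.

(** Church numbers are in FUNC, so each application of [s] is the second component of a pair in its
    graph, to which [counting_inj] applies. *)
Lemma succ_injective_N G n s o :
  G ⊢ church_counting n s o -> G ⊢ is_zero o -> G ⊢ is_succ s -> G ⊢ is_N n o s ->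
  G ⊢ succ_injective n s.
Proof.
  intros HC Ho Hs Hn. all x. all y. imp Hx. imp Hy. imp H. dest H.
  obtain (succ_of_ex x) Sx. obtain (succ_of_ex y) Sy.
  pose proof (succ_intro Hs (N_FUNC Ho Hs Hn Hx) Sx) as Px.
  pose proof (succ_intro Hs (N_FUNC Ho Hs Hn Hy) Sy) as Py.
  pose proof (Ap_unique (succ_FUNC Hs) Px H) as Ex.
  pose proof (Ap_unique (succ_FUNC Hs) Py H0) as Ey.
  eapply counting_inj; try eassumption.
  eapply opair_in_eq; [apply prv_eqI | | apply prv_eqI | exact Py].
  exact (prv_trans (prv_sym Ey) (prv_trans (prv_sym H1) Ex)).
Qed.

(** The three outer quantifiers name the constants: [2] is the Church zero, [1]
    the successor and [0] the set of Church numbers. *)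
Theorem theorem19p20 :
  prv INF nil
    (Ex (Ex (Ex
      (is_zero 2 ∧ is_succ 1 ∧ is_N 0 2 1
       ∧ (church_counting 0 1 2 ⇒ infinite 0 ∧ succ_injective 0 1))))).
Proof.
  obtain zero_ex Ho. rename t into o. obtain succ_ex Hs. rename t into s.
  obtain (N_ex o s) Hn. rename t into n.
  ex o. ex s. ex n. ands; try assumption.
  imp HC. ands.
  - exact (infinite_N HC Ho Hs Hn).
  - exact (succ_injective_N HC Ho Hs Hn).
Qed.
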